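(* Let $n\geq 2$ be an integer and let $F_X$ be a free group, freely generated by a set $X$ of cardinality $n$. For a positive integer $d$, let $m(n,d)$ be the maximum cardinality of a distinct difference configuration (DDC) of diameter at most $d$ in $F_X$. Then, as $d\rightarrow\infty$ with $n$ fixed, \[ m(n,d)=(2n-1)^{d/3+O(\log d)}, \] where the implicit constant may depend on $n$. That is, for every $n\ge 2$ there exist constants $C>0$ and $d_0$ (depending only on $n$) such that for all integers $d\geq d_0$, \[ (2n-1)^{d/3-C\log d}\leq m(n,d)\leq (2n-1)^{d/3+C\log d}. \]
   Context: A subset $D$ of a group $G$ is a Distinct Difference Configuration (DDC) if the differences $g^{-1}h$ are distinct as $(g,h)$ ranges over all ordered pairs of distinct elements of $D$; that is, if $g\ne h$, $g'\neq h'$ are elements of $D$ with $g^{-1}h=(g')^{-1}h'$, then $(g,h)=(g',h')$. For a group $G$ with generating set $X$ and $g,h\in G$, $\mathrm{dist}(g,h)$ is the smallest non-negative integer $\ell$ such that $h=gy_1y_2\cdots y_\ell$ for some $y_1,\ldots,y_\ell\in X\cup X^{-1}$ (so $\mathrm{dist}(g,h)$ is the word length of $g^{-1}h$). The diameter of a subset $D\subseteq G$ is the minimum integer $d$ such that $\mathrm{dist}(g,h)\leq d$ for all $g,h\in D$ (if this integer exists). In $F_X$, distances and diameters are taken with respect to the free generating set $X$. *)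

(* Defs.v *)
From mathcomp Require Import all_boot all_order all_algebra.
From mathcomp Require Import all_classical all_reals all_analysis.

Set Implicit Arguments.
Unset Strict Implicit.
Unset Printing Implicit Defensive.

Local Open Scope classical_set_scope.
Local Open Scope card_scope.
Local Open Scope group_scope.

(* Universal property of the free group.  A map X -> H is given as the
   restriction to X of a map f : G -> H (this loses nothing, as H is nonempty).
   A multiplicative map between groups is a group homomorphism. *)
Definition freely_generated (G : groupType) (X : set G) : Prop :=
  forall (H : groupType) (f : G -> H),
    (exists phi : {multiplicative G -> H}, forall x, X x -> phi x = f x) /\
    (forall phi psi : {multiplicative G -> H},
      (forall x, X x -> phi x = f x) -> (forall x, X x -> psi x = f x) ->
      forall g, phi g = psi g).

Definition ddc (G : groupType) (D : set G) : Prop :=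
  forall g h g' h' : G, D g -> D h -> D g' -> D h' ->
    g <> h -> g' <> h' -> g^-1 * h = g'^-1 * h' -> (g, h) = (g', h').

Definition is_min (P : nat -> Prop) (k : nat) : Prop :=
  P k /\ forall l, P l -> (k <= l)%N.

Definition joined_by (G : groupType) (X : set G) (g h : G) (l : nat) : Prop :=
  exists ys : seq G, [/\ size ys = l,
    forall y, y \in ys -> X y \/ exists2 x, X x & y = x^-1 &
    h = g * \prod_(y <- ys) y].

(* [is_dist X g h l] reads dist(g, h) = l, and [is_diameter X D d] reads
   "D has diameter d"; as relations, they do not need a junk value when no
   word, respectively no bound, exists. *)
Definition is_dist (G : groupType) (X : set G) (g h : G) : nat -> Prop :=
  is_min (joined_by X g h).

Definition dist_le (G : groupType) (X : set G) (g h : G) (d : nat) : Prop :=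
  exists2 l, is_dist X g h l & (l <= d)%N.

Definition is_diameter (G : groupType) (X D : set G) : nat -> Prop :=
  is_min (fun d => forall g h, D g -> D h -> dist_le X g h d).

Definition diameter_le (G : groupType) (X D : set G) (d : nat) : Prop :=
  exists2 e, is_diameter X D e & (e <= d)%N.

(* m is the maximum cardinality of a DDC of diameter at most d.  Arbitrary
   subsets D compete, and the existence of m includes that none is infinite. *)
Definition is_max_ddc (G : groupType) (X : set G) (d m : nat) : Prop :=
  (exists D : set G, [/\ ddc D, diameter_le X D d & D #= `I_m]) /\
  (forall D : set G, ddc D -> diameter_le X D d -> D #<= `I_m).

(* Main.v *)
Require Import Defs.
From HB Require Import structures.
From mathcomp Require Import all_boot all_order all_algebra all_field.
From mathcomp Require Import all_classical all_reals all_analysis.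
From mathcomp Require Import finmap zify lra.

(** The free group is handled through reduced words over the 2 n letters
    x, x^-1.  The universal property, applied to the group of permutations of
    the set of words, shows that distinct reduced words have distinct values
    ([ev_inj]), so differences can be computed and counted as reduced words.
    Put q = 2 n - 1; there are about q^k reduced words of length k.

    Upper bound ([ddc_seq_bound]).  A set of diameter d in a tree lies in a
    ball of radius about d/2 ([exists_center]).  Measured from the centre,
    split the configuration according to the prefix of length k.  Two elements
    of a class have a difference of length at most d - 2 k, and a DDC injects
    into its differences: with one representative per class, all the other
    elements are recovered from their difference to their representative.
    Hence the cardinality is at most about q^k + q^(d - 2 k), which the choice
    k = d/3 balances.

    Lower bound ([exists_rectangle_free]).  For reduced words of one length l,
    u^-1 v = u'^-1 v' only happens when u = p s, v = p t, u' = p' s, v' = p' t,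
    so a set of such words is a DDC of diameter at most 2 l as soon as it
    contains no rectangle (p s, p t, p' s, p' t), wherever the words are cut
    ([ddc_rectangle_free]).  Rectangles are excluded algebraically: over a
    finite field take the words A(a) w A(a h(w)), where A encodes a field
    element by a word and h is a polynomial hash of the word w, that is the
    value at a fixed point b of the polynomial having the letters of w as
    coefficients.  If A(a) and w determine a word, so do w and A(a h(w)); a cut
    inside w = y z is harmless because h(y z) = h(y) + b^|y| h(z) is affine in
    each half ([product_code_rectangle_free]).  An average over b shows that h
    is injective and nonzero on about half of the words w when the field is
    larger than the number of words by a factor linear in their length
    ([separating_point], [exists_hash]).  The three blocks thus have almost
    the same length l/3 = d/6, up to O(log d), and the two free ones give
    q^(d/3 - O(log d)) words. *)

Set Implicit Arguments.
Unset Strict Implicit.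
Unset Printing Implicit Defensive.

Local Open Scope classical_set_scope.
Local Open Scope card_scope.

(** * The group of permutations of a type *)

Section SymmetricGroup.
Variable T : Type.

Record sym := Sym {
  fwd :> T -> T; bwd : T -> T; fwdK : cancel fwd bwd; bwdK : cancel bwd fwd }.

HB.instance Definition _ := gen_eqMixin sym.
HB.instance Definition _ := gen_choiceMixin sym.

Lemma sym_ext (s t : sym) : (s : T -> T) =1 t -> s = t.
Proof.
case: s t => [f f' fK f'K] [g g' gK g'K] /= fg.
have efg : f = g by apply/funext.
subst g; have ef' : f' = g'.
  by apply/funext => u; rewrite -{1}(g'K u) fK.
by subst g'; congr Sym; exact: Prop_irrelevance.
Qed.

Definition sym_one : sym := @Sym id id (fun=> erefl) (fun=> erefl).
Definition sym_inv (s : sym) : sym := Sym (@bwdK s) (@fwdK s).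
Definition sym_mul (s t : sym) : sym :=
  Sym (can_comp (@fwdK s) (@fwdK t)) (can_comp (@bwdK t) (@bwdK s)).

Lemma sym_mulA : associative sym_mul. Proof. by move=> s t u; apply: sym_ext. Qed.
Lemma sym_mul1 : left_id sym_one sym_mul. Proof. by move=> s; apply: sym_ext. Qed.
Lemma sym_1mul : right_id sym_one sym_mul. Proof. by move=> s; apply: sym_ext. Qed.
Lemma sym_mulV : left_inverse sym_one sym_inv sym_mul.
Proof. by move=> s; apply: sym_ext => x /=; rewrite fwdK. Qed.
Lemma sym_Vmul : right_inverse sym_one sym_inv sym_mul.
Proof. by move=> s; apply: sym_ext => x /=; rewrite bwdK. Qed.
HB.instance Definition _ :=
  isGroup.Build sym sym_mulA sym_mul1 sym_1mul sym_mulV sym_Vmul.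
End SymmetricGroup.

(** * Reduced words and free groups *)

Section Words.
Variable n : nat.

Definition letter : finType := (bool * 'I_n)%type.
Implicit Types (a b : letter) (u v w s t : seq letter).

Definition linv a : letter := (~~ a.1, a.2).
Definition noncancel a b := b != linv a.
Definition reduced w := sorted noncancel w.
Definition winv w := rev (map linv w).

Lemma linvK : involutive linv.
Proof. by case=> b i; rewrite /linv /= negbK. Qed.

Lemma linv_neq a : linv a != a.
Proof. by case: a => -[] i. Qed.

Lemma noncancel_inv a b : noncancel (linv b) (linv a) = noncancel a b.
Proof. by rewrite /noncancel linvK eq_sym. Qed.

Lemma winvK : involutive winv.
Proof. by move=> w; rewrite /winv map_rev revK mapK //; exact: linvK. Qed.

Lemma size_winv w : size (winv w) = size w.
Proof. by rewrite size_rev size_map. Qed.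

Lemma reduced_winv w : reduced (winv w) = reduced w.
Proof.
rewrite /reduced /winv rev_sorted sorted_map.
by case: w => [|a w] //=; apply: eq_path => b c /=; exact: noncancel_inv.
Qed.

Definition diverge s t :=
  if s is a :: _ then (if t is b :: _ then a != b else true) else true.

Lemma common_prefix u v :
  exists p s t, [/\ u = p ++ s, v = p ++ t & diverge s t].
Proof.
elim: u v => [|a u ih] [|b v].
- by exists [::], [::], [::].
- by exists [::], [::], (b :: v).
- by exists [::], (a :: u), [::].
have [<-|ab] := eqVneq a b.
  by have [p [s [t [-> -> st]]]] := ih v; exists (a :: p), s, t.
by exists [::], (a :: u), (b :: v).
Qed.

(** This is the reduced form of a difference u^-1 v once the common prefix of
    u and v is cancelled. *)
Lemma reduced_winv_cat s t :
  reduced s -> reduced t -> diverge s t -> reduced (winv s ++ t).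
Proof.
case: s => [|a s] //; rewrite -reduced_winv => rs rt.
case: t rt => [|b t rt /= ab]; first by rewrite cats0.
have: last a (winv (a :: s)) = linv a by rewrite /winv /= rev_cons last_rcons.
case: (winv (a :: s)) rs => [|c w] rw.
  by move=> /eqP; rewrite eq_sym (negPf (linv_neq a)).
rewrite /reduced /= cat_path => la.
rewrite [path _ _ w]rw la /= {1}/noncancel linvK.
by rewrite eq_sym ab.
Qed.

Lemma reduced_catr u v : reduced (u ++ v) -> reduced v.
Proof. by move/cat_sorted2 => []. Qed.

(** Left multiplication by a letter on reduced words; it is not injective on
    arbitrary words, hence the extension by the identity below. *)
Definition lact a s :=
  if s is b :: s' then (if b == linv a then s' else a :: s) else [:: a].

Lemma lact_reduced a s : reduced s -> reduced (lact a s).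
Proof.
case: s => [|b s] //= rs; case: eqP => [_|/eqP hb]; first exact: path_sorted rs.
by rewrite /reduced /= rs andbT.
Qed.

Lemma lactK a s : reduced s -> lact (linv a) (lact a s) = s.
Proof.
case: s => [|b s] /=; first by rewrite linvK eqxx.
case: eqP => [-> | _] rs /=; last by rewrite linvK eqxx.
case: s rs => [|c s] //=; rewrite /reduced /= => /andP[].
by rewrite /noncancel => /negPf ->.
Qed.

Lemma size_lact a s : size (lact a s) <= (size s).+1.
Proof. by case: s => [|b s] //=; case: ifP => //= _; lia. Qed.

Lemma lact_cons a s : reduced (a :: s) -> lact a s = a :: s.
Proof.
case: s => [|b s] //; rewrite /reduced /= => /andP[].
by rewrite /noncancel => /negPf ->.
Qed.

Definition lact_total a s := if reduced s then lact a s else s.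

Lemma lact_totalK a : cancel (lact_total a) (lact_total (linv a)).
Proof.
move=> s; rewrite /lact_total; case rs: (reduced s); last by rewrite rs.
by rewrite lact_reduced // lactK.
Qed.

Lemma lact_totalVK a : cancel (lact_total (linv a)) (lact_total a).
Proof. by move=> s; rewrite -{1}(linvK a) lact_totalK. Qed.

Definition letter_sym a : sym (seq letter) :=
  Sym (@lact_totalK a) (@lact_totalVK a).

Section Evaluation.
Variables (G : groupType) (x : 'I_n -> G).
Local Open Scope group_scope.

Definition lval a : G := if a.1 then x a.2 else (x a.2)^-1.
Definition ev w : G := \prod_(a <- w) lval a.

Lemma lvalV a : lval (linv a) = (lval a)^-1.
Proof. by case: a => -[] i; rewrite /lval //= invgK. Qed.

Lemma ev_nil : ev [::] = 1. Proof. exact: big_nil. Qed.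
Lemma ev_cons a w : ev (a :: w) = lval a * ev w. Proof. exact: big_cons. Qed.
Lemma ev_cat u v : ev (u ++ v) = ev u * ev v. Proof. exact: big_cat. Qed.

Lemma ev_winv w : ev (winv w) = (ev w)^-1.
Proof.
elim: w => [|a w ih]; first by rewrite ev_nil invg1.
rewrite /winv /= rev_cons -cats1 ev_cat ev_cons ev_nil mulg1 lvalV.
by rewrite [ev (rev _)]ih ev_cons invgM.
Qed.

Lemma ev_lact a s : ev (lact a s) = lval a * ev s.
Proof.
case: s => [|b s] /=; first by rewrite ev_cons.
by case: eqP => [->|_]; rewrite !ev_cons // lvalV mulVKg.
Qed.

Definition normalize w := foldr lact [::] w.

Lemma normalize_reduced w : reduced (normalize w).
Proof. by elim: w => //= a w; exact: lact_reduced. Qed.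

Lemma size_normalize w : size (normalize w) <= size w.
Proof. by elim: w => //= a w ih; apply: leq_trans (size_lact _ _) _. Qed.

Lemma ev_normalize w : ev (normalize w) = ev w.
Proof. by elim: w => //= a w ih; rewrite ev_lact ev_cons ih. Qed.

(** Van der Waerden's trick: the letters act on words by permutations, freeness
    turns this into an action of the whole group, and a reduced word is the
    image of the empty word under the action of its value. *)
Lemma ev_inj : injective x -> freely_generated (range x) ->
  {in reduced &, injective ev}.
Proof.
move=> xI free.
pose f (g : G) : sym (seq letter) :=
  if pselect (exists i, x i = g) is left e then letter_sym (true, sval (cid e))
  else 1.
have fx i : f (x i) = letter_sym (true, i).
  rewrite /f; case: pselect => [e|]; last by case; exists i.
  by rewrite (xI _ _ (svalP (cid e))).
have [[phi phix] _] := free _ f.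
have phi1 : phi 1 = 1 by apply: (mulgI (phi 1)); rewrite -gmulfM !mulg1.
have phiV g : phi g^-1 = (phi g)^-1.
  by apply: (mulgI (phi g)); rewrite -gmulfM !mulgV phi1.
have phil a : (phi (lval a) : _ -> _) =1 lact_total a.
  case: a => -[] i s; rewrite /lval /= ?phiV phix ?fx //; by exists i.
have phiev w : reduced w -> phi (ev w) [::] = w.
  elim: w => [|a w ih] rw; first by rewrite ev_nil phi1.
  have rw' : reduced w by move: rw; case: (w) => //= b w' /andP[].
  rewrite ev_cons gmulfM /= phil ih // /lact_total rw'; exact: lact_cons.
by move=> u v ru rv euv; rewrite -(phiev u ru) euv phiev.
Qed.

End Evaluation.
End Words.

Lemma ex_is_min (P : nat -> Prop) k : P k -> exists2 m, is_min P m & m <= k.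
Proof.
move=> Pk; have ex : exists m, `[< P m >] by exists k; apply/asboolP.
exists (ex_minn ex); case: ex_minnP => m /asboolP Pm min; last by apply/min/asboolP.
by split=> // l Pl; apply/min/asboolP.
Qed.

Section FreeGroup.
Variables (n : nat) (G : groupType) (x : 'I_n -> G).
Hypotheses (x_inj : injective x) (x_free : freely_generated (range x)).
Implicit Types (u v w s t : seq (letter n)) (g h : G).
Local Open Scope group_scope.

Let evI : {in @reduced n &, injective (ev x)} := ev_inj x_inj x_free.

(** Junk value [[::]] outside the subgroup generated by the letters. *)
Definition nf g : seq (letter n) := xget [::] [set w | reduced w /\ ev x w = g].

Lemma nf_ev w : reduced w -> nf (ev x w) = w.
Proof.
move=> rw; rewrite /nf; have := @xgetPex _ [::] [set u | reduced u /\ ev x u = ev x w].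
by case; [exists w | move=> ru eu; apply: evI].
Qed.

Lemma nf_evn w : nf (ev x w) = normalize w.
Proof. by rewrite -ev_normalize nf_ev // normalize_reduced. Qed.

Definition close d g h := exists2 w, size w <= d & g^-1 * h = ev x w.

Lemma letterE y : range x y \/ (exists2 z, range x z & y = z^-1) <->
  exists a : letter n, y = lval x a.
Proof.
split=> [[[i _ <-]|[_ [i _ <-] ->]]|[[[] i] ->]].
- by exists (true, i).
- by exists (false, i).
- by left; exists i.
- by right; exists (x i) => //; exists i.
Qed.

Lemma joined_byP g h l : joined_by (range x) g h l <->
  exists2 w, size w = l & g^-1 * h = ev x w.
Proof.
split=> [[ys [<- yX ->]]|[w <- gh]].
  rewrite mulKg; elim: ys yX => [|y ys ih] yX.
    by exists [::]; rewrite ?ev_nil ?big_nil.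
  have [//|w sw ew] := ih; first by move=> z zs; apply: yX; rewrite inE zs orbT.
  have /letterE[a ->] : range x y \/ exists2 z, range x z & y = z^-1.
    by apply: yX; rewrite mem_head.
  by exists (a :: w); rewrite /= ?sw // big_cons ew ev_cons.
exists (map (lval x) w); split; first by rewrite size_map.
  by move=> y /mapP[a _ ->]; apply/letterE; exists a.
by rewrite big_map -[X in g * X]gh mulVKg.
Qed.

Lemma dist_leP d g h : dist_le (range x) g h d <-> close d g h.
Proof.
split=> [[l [/joined_byP[w sw e] _] ld]|[w sw e]]; first by exists w; rewrite ?sw.
have [|l lmin lw] := @ex_is_min (joined_by (range x) g h) (size w).
  by apply/joined_byP; exists w.
by exists l => //; apply: leq_trans sw.
Qed.

Lemma diameter_leP d (D : set G) : diameter_le (range x) D d <->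
  (forall g h, D g -> D h -> close d g h).
Proof.
split=> [[e [De _] ed] g h Dg Dh|Dd].
  have /dist_leP[w sw ew] := De _ _ Dg Dh.
  by exists w => //; apply: leq_trans ed.
have [|e emin ed] := @ex_is_min
  (fun d => forall g h, D g -> D h -> dist_le (range x) g h d) d.
  by move=> g h Dg Dh; apply/dist_leP/Dd.
by exists e.
Qed.

Lemma close_nf d g h : close d g h ->
  [/\ ev x (nf (g^-1 * h)) = g^-1 * h, reduced (nf (g^-1 * h))
    & size (nf (g^-1 * h)) <= d].
Proof.
case=> w sw ->; rewrite nf_evn ev_normalize; split => //.
  exact: normalize_reduced.
exact: leq_trans (size_normalize _) sw.
Qed.

(** The centre is the midpoint of a geodesic between two points g0, h0 at
    maximal distance e.  A path from g0 to another point that leaves this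
    geodesic beyond the midpoint is short after it because the whole path has
    length at most e; a path that leaves it earlier is short because its end
    is at distance at most e from h0. *)
Lemma exists_center (s : seq G) d :
  {in s &, forall g h, close d g h} ->
  exists c, {in s, forall g, close (uphalf d) c g}.
Proof.
case: s => [|g1 s0]; first by move=> _; exists 1.
set s := g1 :: s0 => sd.
pose P l := `[< exists g h, [/\ g \in s, h \in s & size (nf (g^-1 * h)) = l] >].
have exP : exists l, P l.
  by eexists; apply/asboolP; exists g1, g1; split; rewrite ?mem_head.
have Pd l : P l -> l <= d.
  by move=> /asboolP[g [h [gs hs <-]]]; case: (close_nf (sd _ _ gs hs)).
case: (ex_maxnP exP Pd) => e /asboolP[g0 [h0 [g0s h0s se]]] emax.
have smax g h : g \in s -> h \in s -> size (nf (g^-1 * h)) <= e.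
  by move=> gs hs; apply: emax; apply/asboolP; exists g, h.
have ed : e <= d by apply: Pd; apply/asboolP; exists g0, h0.
have [k1 k2] : e - e./2 <= uphalf d /\ e./2 <= uphalf d.
  have := uphalf_leq ed; rewrite uphalf_half; have := odd_double_half e.
  by rewrite -addnn; case: (odd e) => /=; lia.
have [ew0 rw0 _] := close_nf (sd _ _ g0s h0s).
move: se ew0 rw0; set w0 := nf (g0^-1 * h0) => se ew0 rw0.
exists (g0 * ev x (take e./2 w0)) => g gs.
have [eu ru _] := close_nf (sd _ _ g0s gs).
have := smax _ _ g0s gs.
move: eu ru; set u := nf (g0^-1 * g) => eu ru su.
rewrite /close invgM -mulgA -eu.
have [p [s1 [t [ews eut st]]]] := common_prefix w0 u.
have sw : size p + size s1 = e by rewrite -se ews size_cat.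
have sut : size p + size t = size u by rewrite eut size_cat.
(* g branches off the geodesic after, respectively before, its midpoint. *)
have [kp|pk] := leqP e./2 (size p).
  exists (drop e./2 u); first by rewrite size_drop; lia.
  rewrite -{1}(cat_take_drop e./2 u) ev_cat.
  by rewrite ews eut !takel_cat // mulKg.
have rs1 : reduced s1 by move: rw0; rewrite ews; apply: reduced_catr.
have rt : reduced t by move: ru; rewrite eut; apply: reduced_catr.
have : size (nf (h0^-1 * g)) <= e by exact: smax.
have -> : h0^-1 * g = ev x (winv s1 ++ t).
  rewrite ev_cat ev_winv -[h0](mulVKg g0) -ew0 ews -[g](mulVKg g0) -eu eut.
  by rewrite !ev_cat !invgM -!mulgA mulKg mulKg.
rewrite nf_ev ?reduced_winv_cat // size_cat size_winv => sst.
exists (winv (take (e./2 - size p) s1) ++ t).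
  by rewrite size_cat size_winv size_take; case: ltnP => ?; lia.
rewrite ews take_cat ltnNge (ltnW pk) /= eut !ev_cat ev_winv invgM -mulgA.
by rewrite mulKg.
Qed.

End FreeGroup.

(** * Counting reduced words *)

Section Counting.
Variable n : nat.
Implicit Types (a b : letter n) (w : seq (letter n)).

Fixpoint extensions k a : seq (seq (letter n)) :=
  if k is k'.+1 then
    [seq b :: w | b <- enum (noncancel a), w <- extensions k' b]
  else [:: [::]].

Lemma mem_extensions k a w :
  (w \in extensions k a) = (size w == k) && path (@noncancel n) a w.
Proof.
elim: k a w => [|k ih] a [|b w] //=.
  by apply/allpairsPdep => -[? [? []]].
rewrite eqSS; apply/allpairsPdep/idP => [[b' [w' [hb hw [-> ->]]]]|].
  move: hb hw; rewrite mem_enum ih => hb /andP[-> ->].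
  by rewrite andbT; exact: hb.
by case/and3P => sw hb hw; exists b, w; rewrite mem_enum ih sw hw.
Qed.

Lemma extensions_uniq k a : uniq (extensions k a).
Proof.
elim: k a => //= k ih a; apply: allpairs_uniq_dep => //.
- exact: enum_uniq.
- by move=> [b w] [b' w'] _ _ /= [-> ->].
Qed.

Lemma size_extensions k a : size (extensions k a) = ((2 * n - 1) ^ k)%N.
Proof.
elim: k a => //= k ih a; rewrite size_allpairs_dep.
rewrite (eq_map (g := fun=> ((2 * n - 1) ^ k)%N)); last by move=> b; exact: ih.
have -> : [seq ((2 * n - 1) ^ k)%N | _ <- enum (noncancel a)]
  = nseq #|noncancel a| ((2 * n - 1) ^ k)%N.
  by rewrite cardE; elim: (enum _) => //= c l ->.
rewrite sumn_nseq expnS mulnC; congr (_ * _).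
have := cardC1 (linv a); rewrite card_prod card_bool card_ord subn1 => <-.
by apply: eq_card => b.
Qed.

(** Any reduced word can follow a or a^-1, since its first letter cannot be
    the inverse of both; this gives the factor 2. *)
Lemma size_reduced_seq (ws : seq (seq (letter n))) k : 0 < n -> uniq ws ->
  {in ws, forall w, reduced w /\ size w <= k} ->
  size ws <= 2 * k.+1 * (2 * n - 1) ^ k.
Proof.
move=> n0 uws wsP; pose a : letter n := (true, Ordinal n0).
pose ball := flatten
  [seq extensions i a ++ extensions i (linv a) | i <- iota 0 k.+1].
have sub : {subset ws <= ball}.
  move=> w /wsP[rw sw]; apply/flattenP.
  exists (extensions (size w) a ++ extensions (size w) (linv a)).
    by apply/mapP; exists (size w) => //; rewrite mem_iota add0n ltnS.
  rewrite mem_cat !mem_extensions eqxx /=; case: w rw {sw} => [//|b w].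
  rewrite /reduced /= => ->; rewrite !andbT /noncancel linvK.
  by case: eqVneq => // ->; rewrite linv_neq.
apply: leq_trans (uniq_leq_size uws sub) _.
rewrite size_flatten /shape -map_comp sumnE big_map.
have -> : (2 * k.+1 * (2 * n - 1) ^ k)%N =
  (\sum_(i <- iota 0 k.+1) 2 * (2 * n - 1) ^ k)%N.
  by rewrite big_const_seq count_predT size_iota iter_addn_0; lia.
rewrite big_seq [leqRHS]big_seq; apply: leq_sum => i.
rewrite mem_iota /= add0n => ik; rewrite size_cat !size_extensions addnn -mul2n.
by rewrite leq_mul2l /=; apply: leq_pexp2l; lia.
Qed.

End Counting.

(** * The upper bound *)

Section UpperBound.
Variables (n : nat) (G : groupType) (x : 'I_n -> G).
Hypotheses (x_inj : injective x) (x_free : freely_generated (range x)).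
Implicit Types (u v w : seq (letter n)) (g h : G).
Local Open Scope group_scope.

(** The first summand counts one representative for each prefix of length k,
    the second one the differences between the other elements and their
    representatives. *)
Lemma ddc_seq_bound (s : seq G) d k : 0 < n ->
  uniq s -> ddc [set g | g \in s] -> {in s &, forall g h, close x d g h} ->
  size s <= (2 * k.+1 * (2 * n - 1) ^ k +
     2 * (2 * (uphalf d - k)).+1 * (2 * n - 1) ^ (2 * (uphalf d - k)))%N.
Proof.
move=> n0 us ds sd; have [c cs] := exists_center x_inj x_free sd.
set r := uphalf d in cs *.
pose W g := nf x (c^-1 * g); pose cl g := take k (W g).
have WP g : g \in s -> [/\ ev x (W g) = c^-1 * g, reduced (W g) & size (W g) <= r].
  by move=> gs; apply: close_nf (cs _ gs).
pose rep g := nth g s (find (fun h => cl h == cl g) s).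
have has_cl g : g \in s -> has (fun h => cl h == cl g) s.
  by move=> gs; apply/hasP; exists g.
have repP g : g \in s -> rep g \in s /\ cl (rep g) = cl g.
  move=> gs; have hc := has_cl _ gs; split; first by rewrite mem_nth -?has_find.
  by apply/eqP; exact: (nth_find g hc).
have rep_eq g h : g \in s -> h \in s -> cl g = cl h -> rep g = rep h.
  move=> gs hs e; rewrite /rep e; apply: set_nth_default.
  by rewrite -has_find has_cl.
pose isrep g := rep g == g.
rewrite -(count_predC isrep s) -!size_filter; apply: leq_add.
  rewrite -(size_map cl); apply: size_reduced_seq => //.
    rewrite map_inj_in_uniq ?filter_uniq // => g h.
    rewrite !mem_filter => /andP[/eqP rg gs] /andP[/eqP rh hs] e.
    by rewrite -rg -rh; exact: rep_eq.
  move=> w /mapP[g]; rewrite mem_filter => /andP[_ /WP[_ rW _]] ->.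
  by rewrite /reduced take_sorted // size_take; split => //; case: ltnP.
have diff g : g \in s -> exists2 w, size w <= (2 * (r - k))%N &
    (rep g)^-1 * g = ev x w.
  move=> gs; have [rs ecl] := repP _ gs.
  have [[eg _ sg] [er _ sr]] := (WP _ gs, WP _ rs).
  exists (winv (drop k (W (rep g))) ++ drop k (W g)).
    by rewrite size_cat size_winv !size_drop; lia.
  have dec h : h \in s -> c * (ev x (cl h) * ev x (drop k (W h))) = h.
    by move=> /WP[eh _ _]; rewrite -ev_cat cat_take_drop eh mulVKg.
  have quot (p q q' : G) : (c * (p * q))^-1 * (c * (p * q')) = q^-1 * q'.
    by rewrite !invgM -!mulgA !mulKg.
  rewrite ev_cat ev_winv -(quot (ev x (cl g)) (ev x (drop k (W (rep g))))) (dec _ gs).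
  by rewrite -ecl (dec _ rs).
rewrite -(size_map (fun g => nf x ((rep g)^-1 * g))).
have nfP g : g \in s -> [/\ ev x (nf x ((rep g)^-1 * g)) = (rep g)^-1 * g,
    reduced (nf x ((rep g)^-1 * g)) & size (nf x ((rep g)^-1 * g)) <= (2 * (r - k))%N].
  by move=> gs; apply: close_nf => //; exact: diff.
apply: size_reduced_seq => //.
  rewrite map_inj_in_uniq ?filter_uniq // => g h.
  rewrite !mem_filter => /andP[/eqP rg gs] /andP[/eqP rh hs] e.
  have [eg _ _] := nfP _ gs; have [eh _ _] := nfP _ hs.
  have [[rgs _] [rhs _]] := (repP _ gs, repP _ hs).
  have e' : (rep g)^-1 * g = (rep h)^-1 * h by rewrite -eg e.
  by case: (ds _ _ _ _ rgs gs rhs hs rg rh e').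
by move=> w /mapP[g]; rewrite mem_filter => /andP[_ /nfP[_ rW sW]] ->.
Qed.
End UpperBound.

(** * Rectangle-free sets of words *)

Definition rectangle_free (T : eqType) (D : seq (seq T)) := forall p p' s t,
  p ++ s \in D -> p ++ t \in D -> p' ++ s \in D -> p' ++ t \in D ->
  p = p' \/ s = t.

Section Ddc.
Variables (n : nat) (G : groupType) (x : 'I_n -> G).
Hypotheses (x_inj : injective x) (x_free : freely_generated (range x)).
Implicit Types (u v w : seq (letter n)) (g h : G).
Local Open Scope group_scope.

(** Cancelling common prefixes turns equal differences into equal reduced words
    s^-1 t = s'^-1 t'; since s and t have the same length, so do s' and t', and
    both halves must agree. *)
Lemma ddc_rectangle_free (D : seq (seq (letter n))) l :
  {in D, forall w, reduced w /\ size w = l} -> rectangle_free D ->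
  ddc [set g | g \in map (ev x) D].
Proof.
move=> DP Drect g h g' h' /= /mapP[u uD ->] /mapP[v vD ->].
move=> /mapP[u' uD' ->] /mapP[v' vD' ->] gh gh'.
have [p [s [t [eu ev1 st]]]] := common_prefix u v.
have [p' [s' [t' [eu' ev1' st']]]] := common_prefix u' v'.
have [[ru su] [rv sv]] := (DP _ uD, DP _ vD).
have [[ru' su'] [rv' sv']] := (DP _ uD', DP _ vD').
have quot (a b c : seq (letter n)) :
    (ev x (a ++ b))^-1 * ev x (a ++ c) = ev x (winv b ++ c).
  by rewrite !ev_cat ev_winv invgM -mulgA mulKg.
rewrite {1}eu {1}ev1 {1}eu' {1}ev1' !quot => e.
subst u v u' v'.
have e' : winv s ++ t = winv s' ++ t'.
  apply: (ev_inj x_inj x_free) => //; apply: reduced_winv_cat => //.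
  - exact: reduced_catr ru.
  - exact: reduced_catr rv.
  - exact: reduced_catr ru'.
  - exact: reduced_catr rv'.
have ss : size s = size s'.
  move: (congr1 size e') su sv su' sv'; rewrite !size_cat !size_winv; lia.
move/eqP: e'; rewrite eqseq_cat ?size_winv // => /andP[/eqP es /eqP et].
have {}es : s = s' by rewrite -(winvK s) es winvK.
subst s' t'; have [->//|est] := Drect _ _ _ _ uD vD uD' vD'.
by case: gh; rewrite est.
Qed.

Lemma close_words u v : close x (size u + size v) (ev x u) (ev x v).
Proof. by exists (winv u ++ v); rewrite ?size_cat ?size_winv // ev_cat ev_winv. Qed.

End Ddc.

(** * Polynomial hashing *)

Section Separation.
Variable F : finFieldType.
Import GRing.Theory.
Local Open Scope ring_scope.

Lemma leq_sum_seq_const (I : eqType) (s : seq I) (f : I -> nat) c :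
  (forall i, i \in s -> (f i <= c)%N) -> (\sum_(i <- s) f i <= size s * c)%N.
Proof.
move=> fc; rewrite mulnC -iter_addn_0 -(count_predT s) -big_const_seq.
by rewrite big_seq [leqRHS]big_seq; apply: leq_sum => i /fc.
Qed.

(** Two distinct polynomials agree at fewer than m points, so a point drawn
    among at least 2 K m points (K the number of polynomials) sees on average
    at most K/2 coincidences. *)
Lemma separating_point (ps : seq {poly F}) m :
  uniq ps -> (forall p, p \in ps -> (size p <= m)%N) -> (2 * size ps * m <= #|F|)%N ->
  exists b : F, (2 * count (fun p =>
    has (fun r => (r != p) && (r.[b] == p.[b])) ps) ps <= size ps)%N.
Proof.
move=> ups psm hF; apply/not_existsP => nob.
pose N b := (\sum_(p <- ps) \sum_(r <- ps) ((r != p) && (r.[b] == p.[b])))%N.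
have Nbig b : (size ps < 2 * N b)%N.
  have := nob b; move/negP; rewrite -ltnNge => /leq_trans; apply.
  rewrite leq_mul2l /= -sum1_count big_mkcond /=; apply: leq_sum => p _.
  case: ifP => // /hasP[r rps hr]; rewrite (big_rem r) //= hr.
  by rewrite -add1n leq_add2l.
have up : (\sum_(b : F) N b <= size ps * (size ps * m))%N.
  rewrite /N exchange_big /=.
  apply: leq_sum_seq_const => p pps; rewrite exchange_big /=.
  apply: leq_sum_seq_const => r rps.
  have [_|rp] := eqVneq r p; first by rewrite big1.
  rewrite -big_mkcond /= sum1dep_card cardE.
  have rp0 : r - p != 0 by rewrite subr_eq0.
  apply: ltnW; apply: leq_trans (max_poly_roots rp0 _ (enum_uniq _)) _.
    by apply/allP => b; rewrite mem_enum inE rootE hornerD hornerN subr_eq0.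
  by apply: leq_trans (size_polyD _ _) _; rewrite size_polyN geq_max !psm.
have low : (#|F| * (size ps).+1 <= 2 * \sum_(b : F) N b)%N.
  by rewrite big_distrr -sum_nat_const /=; apply: leq_sum => b _; exact: Nbig.
have F0 : (0 < #|F|)%N by apply/card_gt0P; exists 0.
nia.
Qed.
End Separation.

(** * The code A(a) w A(a h(w)) *)

Section ProductCode.
Import GRing.Theory.
Variables (T : eqType) (F : finFieldType) (A : F -> seq T) (nu : T -> F) (b : F).
Variables (M L : nat) (B : seq (seq T)).
Local Open Scope ring_scope.

Definition hash w : F := horner_rec (map nu w) b.

Hypotheses (A_inj : injective A) (A_size : forall a, size (A a) = M).
Hypothesis B_size : {in B, forall w, size w = L}.
Hypotheses (hash_inj : {in B &, injective hash}).
Hypotheses (hash_neq0 : {in B, forall w, hash w != 0}).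

Lemma hash_cat u v : hash (u ++ v) = hash u + b ^+ size u * hash v.
Proof.
rewrite /hash; elim: u => [|t u ih] /=; first by rewrite add0r mul1r.
by rewrite ih mulrDl addrAC mulrAC -exprSr.
Qed.

Definition product_word a w := A a ++ w ++ A (a * hash w).
Definition product_code :=
  [seq product_word a w | a <- [seq a <- enum F | a != 0], w <- B].

Lemma product_wordP u : u \in product_code ->
  exists a w, [/\ a != 0, w \in B & u = product_word a w].
Proof.
case/allpairsP => -[a w] /=; rewrite mem_filter => -[/andP[a0 _] wB ->].
by exists a, w.
Qed.

Lemma product_word_inj a w a' w' : w \in B -> w' \in B ->
  product_word a w = product_word a' w' -> a = a' /\ w = w'.
Proof.
move=> wB wB' /eqP; rewrite /product_word !eqseq_cat ?A_size ?B_size //.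
by case/and3P => /eqP /A_inj -> /eqP ->.
Qed.

Lemma product_code_uniq : uniq B -> uniq product_code.
Proof.
move=> uB; apply: allpairs_uniq => //; first by rewrite filter_uniq ?enum_uniq.
move=> [a w] [a' w'] /allpairsP[[a1 w1] /= [_ wB [-> ->]]].
by move=> /allpairsP[[a2 w2] /= [_ wB' [-> ->]]] /product_word_inj[] // -> ->.
Qed.

Lemma size_product_code : size product_code = (#|F|.-1 * size B)%N.
Proof.
rewrite size_allpairs size_filter cardE -(count_predC (pred1 (0 : F))).
by rewrite (count_uniq_mem _ (enum_uniq F)) mem_enum.
Qed.

(** If the cut falls in the first block, then s contains w and a h(w), which
    determine a; if it falls in the last block, then p contains a and w.
    Suppose now that it splits w.  Then the words p s, p t have the same a,
    the words p' s, p' t the same a', the words p s, p' s the same last block,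
    and so do p t, p' t.  As h is affine in the second half of w, the change
    of h(w) from s to t does not depend on the first half, say it is D; then
    a D = a' D, so a = a' or D = 0, and the injectivity of h gives p = p' or
    s = t respectively. *)
Lemma product_code_rectangle_free : rectangle_free product_code.
Proof.
move=> p p' s t /product_wordP[a1 [w1 [n1 B1 e1]]] /product_wordP[a2 [w2 [n2 B2 e2]]].
move=> /product_wordP[a3 [w3 [n3 B3 e3]]] /product_wordP[a4 [w4 [n4 B4 e4]]].
have sz a w : w \in B -> size (product_word a w) = (M + (L + M))%N.
  by move=> wB; rewrite !size_cat !A_size B_size.
have pp : size p = size p'.
  by have := sz a1 w1 B1; have := sz a3 w3 B3; rewrite -e1 -e3 !size_cat; lia.
have st : size s = size t.
  by have := sz a1 w1 B1; have := sz a2 w2 B2; rewrite -e1 -e2 !size_cat; lia.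
have same13 : a1 = a3 -> w1 = w3 -> p = p'.
  move=> ea ew; move: e1; rewrite ea ew -e3 => /eqP.
  by rewrite eqseq_cat // => /andP[/eqP].
have same12 : a1 = a2 -> w1 = w2 -> s = t.
  move=> ea ew; move: e1; rewrite ea ew -e2 => /eqP.
  by rewrite eqseq_cat // => /andP[_ /eqP].
have tailE a w : w \in B -> drop M (product_word a w) = w ++ A (a * hash w).
  by move=> wB; rewrite drop_size_cat.
have headE a w : w \in B -> take (M + L) (product_word a w) = A a ++ w.
  by move=> wB; rewrite /product_word catA take_size_cat // size_cat A_size B_size.
(* The cut is in the first block. *)
have [kM|Mk] := leqP (size p) M.
  left.
  have : drop M (product_word a1 w1) = drop M (product_word a3 w3).
    by rewrite -e1 -e3 !drop_cat -pp ltnNge kM.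
  rewrite !tailE // => /eqP; rewrite eqseq_cat ?B_size // => /andP[/eqP ew].
  rewrite ew => /eqP/A_inj/(mulIf (hash_neq0 B3)) ea.
  exact: same13.
(* The cut is in the last block. *)
have [kML|MLk] := leqP (M + L) (size p).
  right.
  have : take (M + L) (product_word a1 w1) = take (M + L) (product_word a2 w2).
    by rewrite -e1 -e2 !takel_cat.
  rewrite !headE // => /eqP; rewrite eqseq_cat ?A_size // => /andP[/eqP/A_inj ea /eqP ew].
  exact: same12.
(* The cut splits w. *)
have split a w q r : w \in B -> size q = size p -> q ++ r = product_word a w ->
  [/\ A a = take M q, w = drop M q ++ take (L - (size p - M)) r
     & A (a * hash w) = drop (L - (size p - M)) r].
  move=> wB sq e; have eA : A a = take M q.
    have : take M (q ++ r) = A a by rewrite e take_size_cat.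
    by rewrite takel_cat // sq ltnW.
  have ew : w ++ A (a * hash w) = drop M q ++ r.
    by rewrite -(tailE _ _ wB) -e drop_cat sq Mk.
  have sd : size (drop M q) = (size p - M)%N by rewrite size_drop sq.
  have lt : (L < size p - M)%N = false by lia.
  split => //.
    have <- : take L (w ++ A (a * hash w)) = w by rewrite take_size_cat ?B_size.
    by rewrite ew take_cat sd; case: ltnP => //; lia.
  have <- : drop L (w ++ A (a * hash w)) = A (a * hash w) by rewrite drop_size_cat ?B_size.
  by rewrite ew drop_cat sd; case: ltnP => //; lia.
have [eA1 ew1 ec1] := split _ _ _ _ B1 erefl e1.
have [eA2 ew2 ec2] := split _ _ _ _ B2 erefl e2.
have [eA3 ew3 ec3] := split _ _ _ _ B3 (esym pp) e3.
have [eA4 ew4 ec4] := split _ _ _ _ B4 (esym pp) e4.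
have ea2 : a2 = a1 by apply: A_inj; rewrite eA1 eA2.
have ea4 : a4 = a3 by apply: A_inj; rewrite eA3 eA4.
have c13 : a1 * hash w1 = a3 * hash w3 by apply: A_inj; rewrite ec1 ec3.
have c24 : a1 * hash w2 = a3 * hash w4.
  by apply: A_inj; rewrite -{1}ea2 -ea4 ec2 ec4.
have [ea|na] := eqVneq a1 a3.
  left; apply: same13 => //; apply: hash_inj => //.
  by apply: (mulfI n1); rewrite c13 ea.
right; apply: same12; first by rewrite ea2.
apply: hash_inj => //.
have d : hash w1 - hash w2 = hash w3 - hash w4.
  rewrite ew1 ew2 ew3 ew4 !hash_cat !size_drop pp.
  by rewrite !opprD !addrA ![_ + _ - hash _]addrAC !subrr.
have : (a1 - a3) * (hash w1 - hash w2) = 0.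
  by rewrite mulrBl {2}d !mulrBr c13 c24 subrr.
by move/eqP; rewrite mulf_eq0 !subr_eq0 (negPf na) => /eqP.
Qed.

End ProductCode.

(** * Choice of the field and of the hash *)

Lemma finField_of_card N : 1 < N -> exists F : finFieldType, N <= #|F| <= 2 * N.
Proof.
move=> N1; have k0 : 0 < up_log 2 N by rewrite up_log_gt0.
have [F _ cF] := pPrimePowerField (isT : prime 2) k0.
exists F; rewrite cF; have /andP[lo hi] := up_log_bounds (isT : 1 < 2) N1.
rewrite hi /= -[up_log 2 N]prednK // expnS; lia.
Qed.

Lemma card_leq_inj (S T : finType) : #|S| <= #|T| -> exists f : S -> T, injective f.
Proof.
move=> ST; exists (fun z => enum_val (widen_ord ST (enum_rank z))) => y z.
move/enum_val_inj => e; apply: enum_rank_inj; apply: val_inj.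
exact: (congr1 val e).
Qed.

Section Hashing.
Import GRing.Theory.

Lemma Poly_inj_size (R : nzSemiRingType) (s t : seq R) :
  size s = size t -> Poly s = Poly t -> s = t.
Proof.
move=> st e; apply: (@eq_from_nth _ 0%R) => // i _.
by have := congr1 (fun p : {poly R} => p`_i)%R e; rewrite !coef_Poly.
Qed.

(** The zero polynomial is added to those of the words: a word separated from
    it has a nonzero hash. *)
Lemma exists_hash (F : finFieldType) (S : finType) (W : seq (seq S)) L :
  uniq W -> 0 < L -> {in W, forall w, size w = L} ->
  #|S| < #|F| -> 2 * (size W).+1 * L <= #|F| ->
  exists (nu : S -> F) (b : F) (B : seq (seq S)),
    [/\ uniq B, {subset B <= W}, size W <= (2 * size B).+1,
        {in B &, injective (hash nu b)}
      & {in B, forall w, hash nu b w != 0%R}].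
Proof.
move=> uW L0 sW SF hF.
have [|nu' nuI] := @card_leq_inj (option S) F; first by rewrite card_option.
(* Subtracting the value at [None] makes the coding of letters avoid 0. *)
pose nu c := (nu' (Some c) - nu' None)%R.
have nuinj : injective nu by move=> c c' /addIr/nuI[].
have nu0 c : nu c != 0%R by rewrite subr_eq0; apply/eqP => /nuI.
pose P w := Poly (map nu w).
have PI : {in W &, injective P}.
  move=> u v uW' vW' /Poly_inj_size; rewrite !size_map !sW // => /(_ erefl).
  exact: inj_map.
have P0 w : w \in W -> P w != 0%R.
  move=> wW; apply/eqP => /(congr1 (fun p : {poly F} => p`_0)%R).
  rewrite coef_Poly coef0; have := sW _ wW; case: (w) => [|c v] /= e.
    by move: L0; rewrite -e.
  by move/eqP; rewrite (negPf (nu0 c)).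
pose ps := 0%R :: map P W.
have ups : uniq ps.
  rewrite /= map_inj_in_uniq // uW andbT; apply/mapP => -[w wW e].
  by have := P0 _ wW; rewrite -e eqxx.
have psL p : p \in ps -> size p <= L.
  rewrite inE => /orP[/eqP->|/mapP[w wW ->]]; first by rewrite size_poly0.
  by apply: leq_trans (size_Poly _) _; rewrite size_map sW.
have [|b hb] := separating_point ups psL; first by rewrite /= size_map.
pose bad p := has (fun r : {poly F} => (r != p) && (r.[b] == p.[b])%R) ps.
have hashE w : hash nu b w = ((P w).[b])%R by rewrite horner_Poly.
exists nu, b, [seq w <- W | ~~ bad (P w)]; split.
- exact: filter_uniq.
- by move=> w; rewrite mem_filter => /andP[].
- move: hb; rewrite -[fun p => _]/bad /= size_map count_map size_filter.
  have := count_predC (preim P bad) W.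
  rewrite -[count (predC _) W]/(count (fun w => ~~ bad (P w)) W).
  case: (bad 0%R) => /=; lia.
- move=> u v; rewrite !mem_filter => /andP[bu uW'] /andP[_ vW'] e.
  apply: PI => //; apply/eqP; rewrite eq_sym; apply: contraNT bu => ne.
  apply/hasP; exists (P v); first by rewrite inE map_f ?orbT.
  by rewrite ne -!hashE e eqxx.
- move=> w; rewrite mem_filter => /andP[bw wW]; apply: contraNneq bw => e.
  apply/hasP; exists 0%R; first by rewrite mem_head.
  by rewrite eq_sym P0 //= horner0 -hashE e.
Qed.

End Hashing.

(** * Words that can be concatenated freely *)

Section ClosedWords.
Variables (n : nat) (x0 y0 : letter n).
Hypotheses (yx : y0 != x0) (yx' : y0 != linv x0).
Implicit Types (a : letter n) (w : seq (letter n)).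

(** A word following x0 is completed by two letters so that it ends with x0;
    concatenations of such words are then reduced.  The letter x0 can follow
    every letter but x0^-1, after which the detour by y0 is possible. *)
Definition bridge a := if a == linv x0 then y0 else x0.
Definition closed_words k := [seq w ++ [:: bridge (last x0 w); x0] | w <- extensions k x0].

Lemma closed_words_uniq k : uniq (closed_words k).
Proof.
rewrite map_inj_in_uniq ?extensions_uniq // => u v.
rewrite !mem_extensions => /andP[/eqP su _] /andP[/eqP sv _] /eqP.
by rewrite eqseq_cat ?su ?sv // => /andP[/eqP].
Qed.

Lemma size_closed_words k : size (closed_words k) = (2 * n - 1) ^ k.
Proof. by rewrite size_map size_extensions. Qed.

Lemma closed_wordsP k w : w \in closed_words k ->
  [/\ size w = k.+2, path (@noncancel n) x0 w & last x0 w = x0].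
Proof.
case/mapP => u; rewrite mem_extensions => /andP[/eqP su pu] ->.
rewrite size_cat last_cat su addn2 cat_path pu /= andbT; split => //.
rewrite /bridge /noncancel; have [->|la] := eqVneq (last x0 u) (linv x0).
  by rewrite linvK yx -(can_eq (@linvK n)) linvK eq_sym yx'.
by rewrite -(can_eq (@linvK n)) linvK eq_sym la eq_sym linv_neq.
Qed.
End ClosedWords.

(** Here the blocks have lengths L + t + 2, L + 2 and L + t + 2.  The field
    needs 2 (q^L + 1) (L + 2) elements for hashing and has at most twice as
    many, hence at most 8 (L + 2) q^L; the t extra letters make the encoding
    words as numerous. *)
Lemma exists_rectangle_free n L t : 1 < n -> 0 < L -> 8 * (L + 2) <= (2 * n - 1) ^ t ->
  exists D : seq (seq (letter n)),
   [/\ uniq D, rectangle_free D,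
     {in D, forall w, reduced w /\ size w = 3 * L + 2 * t + 6}
     & (2 * n - 1) ^ (2 * L) <= size D].
Proof.
move=> n1 L0 ht; set q := (2 * n - 1) in ht *.
pose x0 : letter n := (true, Ordinal (ltnW n1)).
pose y0 : letter n := (true, Ordinal n1).
have yx : y0 != x0 by [].
have yx' : y0 != linv x0 by [].
set K := q ^ L; have qK : q <= K by rewrite -{1}(expn1 q) leq_pexp2l //; lia.
have [|F /andP[Flo Fhi]] := @finField_of_card (2 * K.+1 * (L + 2)); first by lia.
pose W := closed_words x0 y0 L; pose C := closed_words x0 y0 (L + t).
have WP := @closed_wordsP n x0 y0 yx yx' L; have CP := @closed_wordsP n x0 y0 yx yx' (L + t).
have sW : size W = K by rewrite size_closed_words.
have uW : uniq W by exact: closed_words_uniq.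
have WL : {in W, forall w, size w = L + 2} by move=> w /WP[-> _ _]; rewrite addn2.
have [|||nu [b [B [uB BW sB hI h0]]]] := @exists_hash F (letter n) W (L + 2) uW _ WL.
- by rewrite addn2.
- rewrite card_prod card_bool card_ord; apply: leq_trans Flo.
  by rewrite -mulnA; nia.
- by rewrite sW.
pose A (a : F) := nth [::] C (enum_rank a).
have FC : #|F| <= size C.
  rewrite size_closed_words -/q expnD -/K; apply: leq_trans Fhi _.
  have K0 : 0 < K by lia.
  have : K * (8 * (L + 2)) <= K * q ^ t by rewrite leq_mul2l ht orbT.
  nia.
have AC a : A a \in C by apply: mem_nth; apply: leq_trans FC.
have AI : injective A.
  move=> a a' /eqP; rewrite /A nth_uniq ?closed_words_uniq //.
  - by move/eqP/val_inj/enum_rank_inj.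
  - exact: leq_trans FC.
  - exact: leq_trans FC.
have As a : size (A a) = (L + t + 2) by have [-> _ _] := CP _ (AC a); lia.
have Bs : {in B, forall w, size w = L + 2} by move=> w /BW/WP[-> _ _]; lia.
exists (product_code A nu b B); split.
- exact: (product_code_uniq _ _ AI As Bs uB).
- exact: (product_code_rectangle_free AI As Bs hI h0).
- move=> u /product_wordP[a [w [_ wB ->]]]; split; last first.
    by rewrite !size_cat !As Bs //; lia.
  have [[_ p1 l1] [_ p2 l2]] := (CP _ (AC a), WP _ (BW _ wB)).
  have [_ p3 _] := CP _ (AC (a * hash nu b w)%R).
  by apply: (path_sorted (x := x0)); rewrite !cat_path p1 l1 p2 l2 p3.
- rewrite size_product_code.
  have -> : q ^ (2 * L) = K * K by rewrite mulnC expnM mulnn.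
  rewrite sW in sB; have q3 : 3 <= q by lia.
  (* The field has at least 4 K nonzero elements, which makes up for the words
     lost to hash collisions. *)
  have F1 : 4 * K <= #|F|.-1.
    have : 4 * K + 1 <= 2 * K.+1 * (L + 2) by nia.
    lia.
  have : 4 * K * size B <= #|F|.-1 * size B by rewrite leq_mul2r F1 orbT.
  apply: leq_trans; rewrite mulnAC mulnC leq_mul2l; apply/orP; right.
  lia.
Qed.

(** * The two bounds for the maximal cardinality *)

Section Extremal.
Variables (n : nat) (G : groupType) (x : 'I_n -> G).
Hypotheses (x_inj : injective x) (x_free : freely_generated (range x)).
Hypothesis n_gt1 : 1 < n.
Implicit Types (s : seq G).

Local Notation q := (2 * n - 1).
(** The number of binary digits of d, an integer substitute for log d. *)
Definition bits d := (trunc_log 2 d).+1.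

Definition close_ddc d s :=
  [/\ uniq s, ddc [set g | g \in s] & {in s &, forall g h, close x d g h}].

Lemma bitsP d : d < 2 ^ bits d. Proof. exact: trunc_log_ltn. Qed.

Lemma close_ddc_ub d s : close_ddc d s -> size s <= q ^ (d %/ 3 + bits d + 7).
Proof.
case=> us ds cs; set k := d %/ 3.
have n0 : 0 < n by exact: ltnW.
have q2 : 2 <= q by lia.
apply: leq_trans (ddc_seq_bound x_inj x_free k n0 us ds cs) _.
set e := 2 * (uphalf d - k).
have ek : e <= k + 3.
  rewrite /e /k; have := odd_double_half d; rewrite uphalf_half -addnn.
  by case: (odd d) => /=; lia.
have le1 : 2 * k.+1 * q ^ k <= 2 * (k + 4) * q ^ (k + 3).
  by apply: leq_mul; [lia | apply: leq_pexp2l; lia].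
have le2 : 2 * e.+1 * q ^ e <= 2 * (k + 4) * q ^ (k + 3).
  by apply: leq_mul; [lia | apply: leq_pexp2l; lia].
apply: leq_trans (leq_add le1 le2) _.
have -> : k + bits d + 7 = (bits d + 4) + (k + 3) by lia.
rewrite [leqRHS]expnD addnn -mul2n mulnA leq_mul2r; apply/orP; right.
have lepow : 2 ^ (bits d + 4) <= q ^ (bits d + 4) by rewrite leq_exp2r //; lia.
apply: leq_trans lepow; rewrite expnD.
have := bitsP d; rewrite /k; lia.
Qed.

(** For d so small that L = 0, a single point does. *)
Lemma close_ddc_lb d : exists L,
  d <= 6 * L + 4 * bits d + 33 /\ exists2 s, close_ddc d s & q ^ (2 * L) <= size s.
Proof.
set t := bits d + 4; exists ((d - (4 * t + 12)) %/ 6); set L := _ %/ 6.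
split; first by rewrite /L /t; lia.
have [->|L0] := posnP L.
  exists [:: 1%g] => //; split=> //.
  - move=> g h g' h' /=; rewrite !inE => /eqP-> /eqP-> _ _; by case.
  - by move=> g h; rewrite !inE => /eqP-> /eqP->; exists [::]; rewrite ?ev_nil ?mulVg.
have dL : 6 * L + 4 * t + 12 <= d by rewrite /L in L0 *; lia.
have ht : 8 * (L + 2) <= q ^ t.
  have : 2 ^ t <= q ^ t by rewrite leq_exp2r // /t; lia.
  apply: leq_trans; rewrite /t expnD; have := bitsP d; lia.
have [D [uD rD DP sD]] := exists_rectangle_free n_gt1 L0 ht.
exists (map (ev x) D); last by rewrite size_map.
split.
- rewrite map_inj_in_uniq // => u v /DP[ru _] /DP[rv _]; exact: ev_inj.
- exact: (ddc_rectangle_free x_inj x_free DP rD).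
- move=> g h /mapP[u /DP[_ su] ->] /mapP[v /DP[_ sv] ->].
  have [w sw ew] := close_words x u v; exists w => //.
  apply: leq_trans sw _; rewrite su sv; lia.
Qed.

Lemma card_set_seq s : uniq s -> [set g | g \in s] #= `I_(size s).
Proof.
move=> us; have -> : [set g | g \in s] = [set` [fset g in s]%fset].
  by apply/seteqP; split=> g /=; rewrite in_fset.
by apply/card_eq_fsetP; rewrite card_fseq undup_id.
Qed.

(** An infinite DDC would contain finite ones of every cardinality, so the bound
    on finite configurations also settles arbitrary subsets. *)
Lemma max_ddc_exists d : exists m,
  [/\ is_max_ddc (range x) d m, exists2 s, close_ddc d s & size s = m
    & forall s, close_ddc d s -> size s <= m].
Proof.
pose P N := `[< exists2 s, close_ddc d s & size s = N >].
have exP : exists N, P N.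
  have [L [_ [s sd _]]] := close_ddc_lb d.
  by exists (size s); apply/asboolP; exists s.
have Pub N : P N -> N <= q ^ (d %/ 3 + bits d + 7).
  by move=> /asboolP[s sd <-]; exact: close_ddc_ub.
case: (ex_maxnP exP Pub) => m /asboolP[s sd sm] mmax.
have smax s' : close_ddc d s' -> size s' <= m.
  by move=> sd'; apply: mmax; apply/asboolP; exists s'.
exists m; split; [split | by exists s | exact: smax].
  exists [set g | g \in s]; have [us ds cs] := sd; split => //.
    apply/(diameter_leP x) => g h; exact: cs.
  by rewrite -sm; exact: card_set_seq.
move=> D dD /(diameter_leP x) cD.
have subD (A : {fset G}) : [set` A] `<=` D -> #|` A| <= m.
  move=> AD; apply: smax; split; first exact: fset_uniq.
    by move=> g h g' h' /= /AD ? /AD ? /AD ? /AD ?; exact: dD.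
  by move=> g h /AD ? /AD ?; exact: cD.
have [/finite_fsetP[A DA]|/infinite_set_fset iD] := pselect (finite_set D).
  have /card_eq_fsetP : #|` A| = #|` A| by [].
  rewrite DA => /card_le_eql ->; rewrite card_le_II; apply: subD.
  by rewrite DA.
have [A AD] := iD m.+1; have := subD A AD; lia.
Qed.

End Extremal.

Lemma enum_generators (n : nat) (G : groupType) (X : set G) : X #= `I_n ->
  exists2 x : 'I_n -> G, injective x & X = range x.
Proof.
rewrite card_eq_sym => XI.
have : [set: 'I_n] #= X by apply: card_eq_trans XI; rewrite card_eq_sym; exact: card_II.
move/card_bijP => [f [f' fK f'K]].
exists (fun i => set_val (f (SigSub (in_setT i)))).
  move=> i j /val_inj/(can_inj fK) e; exact: (congr1 val e).
apply/seteqP; split => [g /mem_set Xg|_ [i _ <-]]; last exact: set_valP.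
exists (set_val (f' (SigSub Xg))) => //.
have -> : SigSub (in_setT (set_val (f' (SigSub Xg)))) = f' (SigSub Xg) by exact: val_inj.
by rewrite f'K.
Qed.

Local Open Scope ring_scope.
Import Order.TTheory GRing.Theory Num.Theory.

(** With t the logarithm of d rounded down, so that [bits d] is t + 1, the
    left-hand side is 2 t + 16, at most 18 t since t is positive. *)
Lemma bits_le_ln (R : realType) d : (2 <= d)%N ->
  (2 * bits d + 14)%N%:R <= (18 / ln 2 * ln d%:R : R).
Proof.
move=> d2; have ln2 : 0 < ln (2 : R) by rewrite ln_gt0 // ltr1n.
rewrite mulrAC ler_pdivlMr //.
have le : (trunc_log 2 d)%:R * ln 2 <= ln d%:R :> R.
  rewrite mulr_natl -lnXn // -natrX ler_ln ?posrE ?ltr0n ?expn_gt0 //; last by lia.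
  by rewrite ler_nat trunc_logP //; lia.
have t1 : (0 < trunc_log 2 d)%N by rewrite trunc_log_gt0.
apply: le_trans (_ : (18 * trunc_log 2 d)%N%:R * ln 2 <= _).
  by rewrite ler_wpM2r ?ler_nat ?ltW // /bits; lia.
by rewrite natrM -mulrA ler_wpM2l.
Qed.

Theorem theorem1 (R : realType) (n : nat) (hn : (2 <= n)%N) :
  exists (C : R) (d0 : nat), 0 < C /\
    forall (G : groupType) (X : set G), X #= `I_n -> freely_generated X ->
    forall d : nat, (0 < d)%N -> (d0 <= d)%N ->
    exists2 m : nat, is_max_ddc X d m &
      ((2 * n - 1)%N%:R : R) `^ (d%:R / 3 - C * ln d%:R) <= m%:R
        <= ((2 * n - 1)%N%:R : R) `^ (d%:R / 3 + C * ln d%:R).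
Proof.
have ln2 : 0 < ln (2 : R) by rewrite ln_gt0 // ltr1n.
exists (18 / ln 2), 2%N; split; first by rewrite divr_gt0.
move=> G X /enum_generators[x x_inj ->] x_free d _ d2.
have [m [mmax [s sd sm] smax]] := max_ddc_exists x_inj x_free hn d.
exists m => //; subst m.
have bl := bits_le_ln R d2; set E := _ * ln _ in bl *.
have q1 : 1 <= (2 * n - 1)%N%:R :> R by rewrite ler1n; lia.
apply/andP; split.
  have [L [dL [s' sd' sL]]] := close_ddc_lb x_inj x_free hn d.
  apply: le_trans (_ : (2 * n - 1)%N%:R `^ (2 * L)%N%:R <= _); last first.
    by rewrite powR_mulrn // -natrX ler_nat (leq_trans sL) // smax.
  apply: ler_powR => //.
  have : (d%:R : R) <= (6 * L + 4 * bits d + 33)%N%:R by rewrite ler_nat.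
  move: bl; rewrite !natrD !natrM; have := ler0n R (bits d); lra.
have ub := close_ddc_ub x_inj x_free hn sd.
apply: le_trans (_ : (2 * n - 1)%N%:R `^ (d %/ 3 + bits d + 7)%N%:R <= _).
  by rewrite powR_mulrn // -natrX ler_nat.
apply: ler_powR => //.
have : ((3 * (d %/ 3))%N%:R : R) <= d%:R by rewrite ler_nat; lia.
move: bl; rewrite !natrD !natrM; have := ler0n R (bits d); lra.
Qed.
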